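(* Let $O$ be the optimal ordering for the sum rate, i.e. the feasible ordering $O=\{\{U_2,U_1\},\{U_3,U_1\},\dots,\{U_N,U_1\}\}$ maximizing $S_R$, and let $O'$ be a random (randomly chosen) feasible ordering. Then, for high SNR regimes, $$S_R(G_O)-S_R(G_{O'})\le\frac{1}{2}\log_2\left(\frac{x_N(1+2x_1)}{x_1(1+2x_N)}\right),$$ and consequently $$\lim_{x_1\to\infty}\left(S_R(G_O)-S_R(G_{O'})\right)=0.$$
   Context: A pairwise multiway relay channel with functional-decode-forward relaying has $N\ge2$ users $U_1,\dots,U_N$ with signal-to-noise ratios (SNRs) $x_N\ge x_{N-1}\ge\dots\ge x_1>0$. An ordering $O$ is a set of unordered pairs of distinct users (the pairs that transmit simultaneously to the relay, one pair per uplink phase). Its client graph $G_O=(V,E)$ has $V=\{v_1,\dots,v_N\}$ and $v_iv_j\in E$ iff $\{U_i,U_j\}\in O$. An ordering is feasible if every user, knowing its own message and the pairwise sums of messages corresponding to the pairs in $O$, can recover all messages. Only orderings with $N-1$ pairs are considered; such an ordering is feasible iff $G_O$ is a tree. When $U_i$ transmits paired with $U_j$, its rate $R_i$ is limited by the achievable bound $$R_i\le\max\left\{0,\frac{1}{2(N-1)}\log_2\left(\frac{x_i}{x_i+x_j}+x_i\right)\right\},$$ and the maximum achievable $R_i$ is the minimum of these bounds over all $j$ with $v_iv_j\in E$. $S_R(G_O)$ denotes the maximum achievable sum rate $\sum_{i=1}^N R_i$ for the client graph $G_O$. It is assumed throughout that the users' SNRs are not too low, so that the bound may be used in the form $R_i\le\frac{1}{2(N-1)}\log_2\left(\frac{x_i}{x_i+x_j}+x_i\right)$;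 the two forms are equivalent if $x_1+\frac{x_1}{x_1+x_N}\ge1$, for instance if all SNRs are more than $1$. The ordering $O$ in the claim is optimal subject to this second form of the bound. ''High SNR regimes'' refers to large SNRs, with no explicit threshold specified. *)

(* Defs.v *)
From HB Require Import structures.
From mathcomp Require Import all_boot all_order all_algebra.
From mathcomp Require Import all_classical all_reals all_analysis.
Import numFieldNormedType.Exports.
Import Order.TTheory GRing.Theory Num.Theory.

Set Implicit Arguments.
Unset Strict Implicit.
Unset Printing Implicit Defensive.

Local Open Scope classical_set_scope.
Local Open Scope ring_scope.

(* There are N = n.+2 users, so that N >= 2. User U_(i+1) is i : 'I_n.+2;   *)
(* the weakest user U_1 is ord0 and the strongest user U_N is ord_max.      *)

Section Orderings.
Variable n : nat.

Definition ordering := {set {set 'I_n.+2}}.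

(* N - 1 = n.+1 transmitting pairs. *)
Definition is_ordering (O : ordering) : bool :=
  (#|O| == n.+1) && [forall p in O, #|p| == 2].

(* On an ordering this is irreflexive, since [set i; i] is a singleton. *)
Definition client_graph (O : ordering) : rel 'I_n.+2 :=
  fun i j => [set i; j]%SET \in O.

(* What the relay broadcasts when the messages are w: the sum w_j + w_k for *)
(* every pair {j, k} of O. The value 0 outside O carries no information.    *)
Definition pair_sums (W : zmodType) (O : ordering) (w : 'I_n.+2 -> W) :
    {ffun {set 'I_n.+2} -> W} :=
  [ffun p : {set 'I_n.+2} => if p \in O then \sum_(k in p) w k else 0].

Definition recovers (W : zmodType) (O : ordering) (i : 'I_n.+2) : Prop :=
  exists dec : W -> {ffun {set 'I_n.+2} -> W} -> 'I_n.+2 -> W,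
    forall w : 'I_n.+2 -> W, dec (w i) (pair_sums O w) =1 w.

Definition feasible (W : zmodType) (O : ordering) : Prop :=
  is_ordering O /\ forall i, recovers W O i.

Definition star_ordering : ordering :=
  [set [set i; ord0]%SET | i : 'I_n.+2 & i != ord0]%SET.

End Orderings.

Arguments star_ordering : clear implicits.

Section Rates.
Variables (R : realType) (n : nat).
Implicit Types (x : 'I_n.+2 -> R) (i j : 'I_n.+2).

Definition log2 (a : R) : R := ln a / ln 2.

Definition snr_profile x : Prop :=
  0 < x ord0 /\ (forall i j, (i <= j)%N -> x i <= x j).

Definition log_bound x i j : R :=
  (2 * n.+1%:R)^-1 * log2 (x i / (x i + x j) + x i).

Definition rate_bound x i j : R := Num.max 0 (log_bound x i j).

(* The SNRs are not too low: for every possible pair the maximum with 0 may *)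
(* be dropped. For n.+2 >= 2 ordered positive SNRs this amounts to          *)
(* x_1 + x_1 / (x_1 + x_N) >= 1.                                            *)
Definition not_too_low x : Prop :=
  forall i j, i != j -> rate_bound x i j = log_bound x i j.

(* A minimum over the neighbours of i: the set is finite, and nonempty as   *)
(* soon as i has a neighbour, which holds in every feasible ordering.       *)
Definition max_rate x (e : rel 'I_n.+2) i : R :=
  inf [set rate_bound x i j | j in [set j | e i j]].

Definition sum_rate x (e : rel 'I_n.+2) : R := \sum_i max_rate x e i.

Definition optimal_ordering (W : zmodType) x (O : ordering n) : Prop :=
  feasible W O /\
  forall O', feasible W O' ->
    sum_rate x (client_graph O') <= sum_rate x (client_graph O).

(* The filter "x_1 tends to infinity" on SNR profiles. A property holds     *)
(* near it iff it holds for all profiles with x_1 above some threshold.     *)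
Definition high_snr : set_system ('I_n.+2 -> R) :=
  filter_from [set: R] (fun M => [set x | snr_profile x /\ M <= x ord0]).

End Rates.

Arguments high_snr : clear implicits.

(* Main.v *)
(** Up to a positive factor, the bound on [R_i] imposed by a neighbour [j] is
    [ln x_i + G {i, j}], where [G {i, j} = ln (1 + 1 / (x_i + x_j))] depends
    only on the unordered pair. In a feasible ordering, for every root [r], the
    users other than [r] can be matched bijectively with the pairs of [O], each
    user lying in its pair. Bound each user other than [U_N] by the pair matched
    to it for the root [U_N], and sum: this gives the total gain of all pairs.
    Rematch these pairs for the root [U_1], and use [G {i, j} <= G {i, 1}]: this
    gives the sum rate of the star. For the gap, [U_1] has its worst possible
    rate in the star, and each of the [N - 1] other users loses at most
    [G {1, 1} - G {N, N}]. *)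

Require Import Defs.
From HB Require Import structures.
From mathcomp Require Import all_boot all_order all_algebra.
From mathcomp Require Import all_classical all_reals all_analysis.
From mathcomp Require Import ring lra.
Import numFieldNormedType.Exports.
Import Order.TTheory GRing.Theory Num.Theory.

Set Implicit Arguments.
Unset Strict Implicit.
Unset Printing Implicit Defensive.

Local Open Scope classical_set_scope.
Local Open Scope ring_scope.

(** * Matching users with the pairs of a feasible ordering *)

(** Linear form of recoverability, relative to a vertex set [S] so that it survives the removal of a
    leaf. *)
Definition determined (V : finType) (W : zmodType)
    (S : {set V}) (E : {set {set V}}) : Prop :=
  forall (i : V) (w : V -> W), i \in S -> w i = 0 ->
    (forall p : {set V}, p \in E -> \sum_(k in p) w k = 0) ->
    forall j : V, j \in S -> w j = 0.

(** Double counting: the degrees sum to [2 * #|E|], so if all were at least 2, then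
    [#|S| <= #|E|]. *)
Lemma exists_degree_le1 (V : finType) (S : {set V}) (E : {set {set V}}) :
  (#|E| < #|S|)%N -> (forall p : {set V}, p \in E -> p \subset S /\ #|p| = 2%N) ->
  exists2 v : V, v \in S & (#|[set p in E | v \in p]%SET| <= 1)%N.
Proof.
move=> ltES hE; apply/exists_inP; apply: contraLR ltES => /exists_inPn hdeg.
rewrite -leqNgt -(leq_pmul2r (isT : 0 < 2)%N) -!sum_nat_const.
have -> : (\sum_(p in E) 2 = \sum_(p in E) \sum_(v in S) (v \in p))%N.
  apply: eq_bigr => p /hE [pS p2]; rewrite -p2 -sum1_card big_mkcond /=.
  rewrite [RHS]big_mkcond /=; apply: eq_bigr => v _.
  by case: (boolP (v \in p)) => [/(fintype.subsetP pS)->|_] //; case: ifP.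
rewrite exchange_big /=; apply: leq_sum => v /hdeg.
rewrite -ltnNge => /leq_trans; apply; rewrite -sum1_card big_mkcond /=.
rewrite [leqRHS]big_mkcond /=; apply: leq_sum => p _.
by rewrite inE; case: (p \in E); case: (v \in p).
Qed.

(* Over a W of odd order an odd cycle determines its messages, so [determined] *)
(* does not give connectedness directly; leaves are peeled off instead. The    *)
(* induction removes a vertex v of degree 1, with edge {v, u}: a root r != v   *)
(* is kept, and the root v is replaced by u.                                   *)
Lemma incident_edge_choice (V : finType) (W : zmodType) (S : {set V})
    (E : {set {set V}}) (r : V) :
  (exists w : W, w != 0) -> #|E|.+1 = #|S| ->
  (forall p : {set V}, p \in E -> p \subset S /\ #|p| = 2%N) ->
  determined W S E -> r \in S ->
  exists phi : V -> {set V},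
    {in S :\ r &, injective phi} /\
    (forall v, v \in S :\ r -> phi v \in E /\ v \in phi v).
Proof.
move=> [w0 w0N0]; move eqm : #|S| => m.
elim: m => // m IH in S E r eqm *; move=> [eqE] hE det rS.
have [m0|m_gt0] := posnP m.
  have Sr0 : S :\ r = finset.set0.
    by apply/eqP; rewrite -cards_eq0; move: (cardsD1 r S); rewrite rS eqm m0 add1n => -[<-].
  by exists (fun=> finset.set0); split=> [v|v]; rewrite Sr0 inE.
have [|v vS] := @exists_degree_le1 V S E _ hE; first by rewrite eqE eqm.
have cSv : #|S :\ v| = m by move: (cardsD1 v S); rewrite vS eqm add1n => -[<-].
rewrite leq_eqVlt ltnS leqn0 cards_eq0 => /orP[/cards1P[e eqe]|/eqP deg0]; last first.
  (* Degree 0 is impossible: the message [w0] at [v] and 0 elsewhere has zero pair sums and vanishes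
     at [u]. *)
  have /card_gt0P[u uSv] : (0 < #|S :\ v|)%N by rewrite cSv.
  move: uSv; rewrite !inE => /andP[uv uS].
  suff : (if v == v then w0 else 0) = 0 by rewrite eqxx; move/eqP: w0N0.
  apply: (det u (fun k => if k == v then w0 else 0)) => //; first by rewrite (negbTE uv).
  move=> p pE; apply: big1 => k kp; case: eqP => // kv.
  by have : p \in finset.set0; [rewrite -deg0 inE pE -kv|rewrite inE].
have /[!inE] /andP[eE ve] : e \in [set p in E | v \in p]%SET by rewrite eqe finset.set11.
have only_e p : p \in E -> v \in p -> p = e.
  by move=> pE vp; apply/set1P; rewrite -eqe inE pE.
have [eS e2] := hE e eE.
have /cards1P[u eu] : #|e :\ v| == 1%N by move: (cardsD1 v e); rewrite ve e2 add1n => -[<-].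
have /[!inE] /andP[uv ue] : u \in e :\ v by rewrite eu finset.set11.
have uS : u \in S := fintype.subsetP eS u ue.
have IHv r' : r' \in S :\ v -> exists phi : V -> {set V},
    {in (S :\ v) :\ r' &, injective phi} /\
    (forall k, k \in (S :\ v) :\ r' -> phi k \in E :\ e /\ k \in phi k).
  apply: IH => //.
  - by move: (cardsD1 e E); rewrite eE eqE add1n => ->.
  - move=> p /[!inE] /andP[pe pE]; have [pS p2] := hE p pE; split=> //.
    apply/fintype.subsetP => k kp; rewrite !inE (fintype.subsetP pS k kp) andbT.
    by apply: contra_neq pe => kv; apply: only_e; rewrite // -kv.
  - move=> i w /[!inE] /andP[iv iS] wi0 hw j /[!inE] /andP[jv jS].
    (* The value [- w u] at the leaf [v] makes the sum over its edge [e = {v, u}] vanish. *)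
    pose w' k := if k == v then - w u else w k.
    have -> : w j = w' j by rewrite /w' (negbTE jv).
    apply: (det i w') => //; first by rewrite /w' (negbTE iv).
    move=> p pE; have [->|pe] := eqVneq p e.
      rewrite (big_setD1 v) //= eu big_set1 /w' eqxx (negbTE uv).
      by rewrite addNr.
    rewrite -[RHS](hw p) ?inE ?pe //; apply: eq_bigr => k kp; rewrite /w'.
    by case: eqP => // kv; case/eqP: pe; apply: only_e; rewrite // -kv.
(* [k0] is the vertex to be matched with [e], and [r'] is the root for [S :\ v]. *)
suff [r' [k0 [r'S k0e hk]]] : exists r' k0, [/\ r' \in S :\ v, k0 \in e &
    forall k, k \in S :\ r -> k != k0 -> k \in (S :\ v) :\ r'].
  have [phi [phi_inj phiP]] := IHv r' r'S.
  exists (fun k => if k == k0 then e else phi k); split; last first.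
    move=> k kS; case: eqVneq => [->//|kk0].
    by have [/[!inE] /andP[]] := phiP k (hk k kS kk0).
  move=> k l kS lS /=; case: (eqVneq k k0) => [->|kk0]; case: (eqVneq l k0) => [->|lk0] //.
  - by move=> ee; have [] := phiP l (hk l lS lk0); rewrite -ee !inE eqxx.
  - by move=> ee; have [] := phiP k (hk k kS kk0); rewrite ee !inE eqxx.
  - by apply: phi_inj; apply: hk.
have [rv|rv] := eqVneq r v.
  exists u, u; split=> //; first by rewrite !inE uv.
  by move=> k /[!inE] /andP[kr kS] ku; rewrite ku kS -rv kr.
exists r, v; split=> //; first by rewrite !inE rv.
by move=> k /[!inE] /andP[kr kS] kv; rewrite kr kv.
Qed.

(** The decoder of [i] receives the same data from [w] as from the zero message, hence returns the
    same output. *)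
Lemma feasible_determined (n : nat) (W : zmodType) (O : ordering n) :
  feasible W O -> determined W [set: 'I_n.+2]%SET O.
Proof.
move=> [_ rec] i w _ wi0 hw j _; have [dec hdec] := rec i.
rewrite -(hdec w j) -[RHS](hdec (fun=> 0) j) wi0.
congr (dec _ _ _); apply/ffunP => p; rewrite !ffunE.
by case: ifP => // /hw ->; rewrite big1.
Qed.

Lemma feasible_edge_choice (n : nat) (W : zmodType) (O : ordering n) (r : 'I_n.+2) :
  (exists w : W, w != 0) -> feasible W O ->
  exists phi : 'I_n.+2 -> {set 'I_n.+2},
    [/\ {in [set~ r]%SET &, injective phi},
        [set phi v | v in [set~ r]]%SET = O
      & forall v, v != r -> exists j, [/\ phi v = [set v; j]%SET, j != v
                                     & client_graph O v j]].
Proof.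
move=> hW fO; have [/andP[/eqP cO /forall_inP hO] _] := fO.
have [|||phi [phi_inj phiP]] := @incident_edge_choice _ _ [set: 'I_n.+2]%SET O r
    hW _ _ (feasible_determined fO).
- by rewrite cO cardsT card_ord.
- by move=> p /hO /eqP; split; first exact: finset.subsetT.
- by rewrite inE.
have inj : {in [set~ r]%SET &, injective phi}.
  by move=> k l /[!inE] kr lr; apply: phi_inj; rewrite !inE ?kr ?lr.
exists phi; split=> //.
  (* [N - 1] users map injectively into [N - 1] pairs, so every pair is hit. *)
  apply/eqP; rewrite eqEcard card_in_imset // cardsC1 card_ord cO leqnn andbT.
  apply/fintype.subsetP => _ /imsetP[v /[!inE] vr ->].
  by have [|] := phiP v; rewrite ?inE ?vr.
move=> v vr; have [|pO vp] := phiP v; first by rewrite !inE vr.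
have /eqP p2 := hO _ pO.
have /cards1P[j ej] : #|phi v :\ v| == 1%N.
  by move: (cardsD1 v (phi v)); rewrite vp p2 add1n => -[<-].
have eqp : phi v = [set v; j]%SET by rewrite -(finset.setD1K vp) ej.
have /[!inE] /andP[jv _] : j \in phi v :\ v by rewrite ej finset.set11.
by exists j; rewrite /client_graph -eqp.
Qed.

(** For any root other than [i], the pair matched with [i] yields a neighbour. This keeps the set in
    [max_rate] nonempty. *)
Lemma feasible_neighbour (n : nat) (W : zmodType) (O : ordering n) (i : 'I_n.+2) :
  (exists w : W, w != 0) -> feasible W O ->
  exists2 j, j != i & client_graph O i j.
Proof.
move=> hW fO; have [r ri] : exists r : 'I_n.+2, i != r.
  by exists (if i == ord0 then ord_max else ord0); case: (eqVneq i ord0) => [->|].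
by have [phi [_ _ /(_ i ri)[j [_ ji ij]]]] := feasible_edge_choice r hW fO; exists j.
Qed.

(** * The star ordering and its feasibility *)

Lemma client_graph_star (n : nat) (i j : 'I_n.+2) :
  client_graph (star_ordering n) i j = (i != j) && ((i == ord0) || (j == ord0)).
Proof.
rewrite /client_graph; apply/imsetP/andP.
  case=> k /[!inE] k0 eqk.
  have : i \in [set i; j]%SET by rewrite !inE eqxx.
  have : j \in [set i; j]%SET by rewrite !inE eqxx orbT.
  have : k \in [set i; j]%SET by rewrite eqk !inE eqxx.
  have : ord0 \in [set i; j]%SET by rewrite eqk !inE eqxx orbT.
  rewrite {3 4}eqk !inE => h1 h2 h3 h4; split; last by rewrite eq_sym [j == _]eq_sym.
  apply: contra_neqN k0 => /eqP ij; move: h1 h2; rewrite -ij !orbb => /eqP-> /eqP->.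
  by [].
case=> ij /orP[/eqP i0|/eqP j0].
  by exists j; rewrite ?inE -i0 1?eq_sym// finset.setUC.
by exists i; rewrite ?inE -j0.
Qed.

Lemma feasible_star (n : nat) (W : zmodType) : feasible W (star_ordering n).
Proof.
split.
  apply/andP; split.
    rewrite card_in_imset; last first.
      move=> k l /[!inE] k0 l0 /= eqkl.
      have : k \in [set l; ord0]%SET by rewrite -eqkl !inE eqxx.
      by rewrite !inE (negbTE k0) orbF => /eqP.
    by rewrite cardsE (cardC1 (ord0 : 'I_n.+2)) card_ord.
  by apply/forall_inP => _ /imsetP[k /[!inE] k0 ->]; rewrite cards2 k0.
move=> i.
(* [m0] is the message of [U_1]; subtracting it from the pair sums gives all the others. *)
exists (fun a s => let m0 := if i == ord0 then a else s [set i; ord0]%SET - a in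
  fun j => if j == ord0 then m0 else s [set j; ord0]%SET - m0).
move=> w j /=.
have sumE k : k != ord0 -> pair_sums (star_ordering n) w [set k; ord0]%SET = w k + w ord0.
  move=> k0; have := client_graph_star k ord0.
  rewrite /client_graph k0 eqxx orbT ffunE => ->.
  by rewrite big_setU1 ?inE //= finset.big_set1.
have -> : (if i == ord0 then w i
    else pair_sums (star_ordering n) w [set i; ord0]%SET - w i) = w ord0.
  by case: eqVneq => [->//|/sumE->]; rewrite addrC addKr.
by case: eqVneq => [->//|/sumE->]; rewrite addrK.
Qed.

(** * Rate bounds and their monotonicity *)

Section RateBounds.
Variables (R : realType) (n : nat).
Implicit Types (x : 'I_n.+2 -> R) (e : rel 'I_n.+2) (i j k : 'I_n.+2).

Definition log_scale : R := (2 * n.+1%:R)^-1 / ln 2.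

(* The gain depends on the pair as a set only: this symmetry lets gains be   *)
(* summed over the edges of the client graph.                                *)
Definition pair_gain x (p : {set 'I_n.+2}) : R := ln (1 + (\sum_(k in p) x k)^-1).

Lemma log_scale_gt0 : 0 < log_scale.
Proof. by rewrite divr_gt0 ?invr_gt0 ?mulr_gt0 ?ln_gt0 ?ltr1n. Qed.

Lemma snr_gt0 x i : snr_profile x -> 0 < x i.
Proof. by move=> [x0 mx]; apply: lt_le_trans x0 (mx _ _ _). Qed.

Lemma snr_ge_min x i : snr_profile x -> x ord0 <= x i.
Proof. by move=> [_]; apply. Qed.

Lemma snr_le_max x i : snr_profile x -> x i <= x ord_max.
Proof. by move=> [_]; apply; rewrite -ltnS ltn_ord. Qed.

Lemma ln1Dinv_le (a b : R) : 0 < a -> a <= b -> ln (1 + b^-1) <= ln (1 + a^-1).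
Proof.
move=> a0 ab; have b0 := lt_le_trans a0 ab.
by rewrite ler_ln ?posrE ?addr_gt0 ?invr_gt0 // lerD2l lef_pV2.
Qed.

(** Factoring out [x i] leaves [1 + (x i + x j)^-1], which is symmetric in [i] and [j]. *)
Lemma log_boundE x i j : snr_profile x ->
  log_bound x i j = log_scale * (ln (x i) + ln (1 + (x i + x j)^-1)).
Proof.
move=> hx; have [xi xj] := (snr_gt0 i hx, snr_gt0 j hx).
rewrite -lnM ?posrE ?addr_gt0 ?invr_gt0 ?addr_gt0 //.
by rewrite /log_bound /log2 /log_scale mulrDr mulr1 [x i + _ / _]addrC mulrA mulrAC.
Qed.

Lemma log_bound_pair x i j : snr_profile x -> j != i ->
  log_bound x i j = log_scale * (ln (x i) + pair_gain x [set i; j]%SET).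
Proof.
move=> hx ji; rewrite log_boundE // /pair_gain.
by rewrite big_setU1 ?inE 1?eq_sym //= finset.big_set1.
Qed.

Lemma log_bound_le x i j k : snr_profile x -> x j <= x k ->
  log_bound x i k <= log_bound x i j.
Proof.
move=> hx jk; rewrite !log_boundE // ler_pM2l ?log_scale_gt0 // lerD2l.
by rewrite ln1Dinv_le ?addr_gt0 ?snr_gt0 // lerD2l.
Qed.

Lemma rate_bound_le x i j k : snr_profile x -> x j <= x k ->
  rate_bound x i k <= rate_bound x i j.
Proof.
by move=> hx jk; rewrite /rate_bound ge_max !le_max lexx log_bound_le ?orbT.
Qed.

Lemma max_rate_le x e i j : e i j -> max_rate x e i <= rate_bound x i j.
Proof.
move=> eij; apply: ge_inf; last by exists j.
by exists 0 => _ [k _ <-]; rewrite /rate_bound le_max lexx.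
Qed.

Lemma le_max_rate x e i j (y : R) : e i j ->
  (forall k, e i k -> y <= rate_bound x i k) -> y <= max_rate x e i.
Proof.
move=> eij hy; apply: lb_le_inf; first by exists (rate_bound x i j); exists j.
by move=> _ [k eik <-]; apply: hy.
Qed.

(** The strongest user is the worst partner. For [i = ord_max] this floor is a fictitious pairing of
    [U_N] with itself. *)
Lemma rate_bound_max_le_max_rate x e i j : snr_profile x -> e i j ->
  rate_bound x i ord_max <= max_rate x e i.
Proof.
move=> hx eij; apply: (le_max_rate eij) => k _.
by apply: rate_bound_le => //; apply: snr_le_max.
Qed.

Lemma max_rate_le_log_bound x e i j : not_too_low x -> j != i -> e i j ->
  max_rate x e i <= log_bound x i j.
Proof. by move=> hl ji eij; rewrite -hl 1?eq_sym // max_rate_le. Qed.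

(** Both logarithms are nonnegative. The case [i = j] is included for the fictitious pairing of
    [U_N] with itself. *)
Lemma not_too_low_ge1 x : snr_profile x -> 1 <= x ord0 ->
  forall i j, rate_bound x i j = log_bound x i j.
Proof.
move=> hx x1 i j; apply/max_idPr; rewrite log_boundE //.
rewrite mulr_ge0 ?addr_ge0 ?(ltW log_scale_gt0) // ln_ge0 //.
  exact: le_trans x1 (snr_ge_min i hx).
by rewrite lerDl invr_ge0 addr_ge0 // ltW // snr_gt0.
Qed.

(** * Optimality of the star *)

Lemma star_optimal x (W : zmodType) (O : ordering n) :
  (exists w : W, w != 0) -> snr_profile x -> not_too_low x -> feasible W O ->
  sum_rate x (client_graph O) <= sum_rate x (client_graph (star_ordering n)).
Proof.
move=> hW hx hl fO.
pose g i := ln (1 + (x i + x ord0)^-1).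
have gE i : i != ord0 -> pair_gain x [set i; ord0]%SET = g i.
  by move=> i0; rewrite /pair_gain big_setU1 ?inE //= finset.big_set1.
have g_edge i j : j != i -> pair_gain x [set i; j]%SET <= g i.
  move=> ji; rewrite /pair_gain big_setU1 ?inE 1?eq_sym //= finset.big_set1.
  by rewrite ln1Dinv_le ?addr_gt0 ?snr_gt0 // lerD2l snr_ge_min.
have K0 := log_scale_gt0.
have [phi [phi_inj phiO phiP]] := feasible_edge_choice ord_max hW fO.
have [psi [psi_inj psiO psiP]] := feasible_edge_choice ord0 hW fO.
(* Both matchings enumerate [O] exactly once, so both sums are the total gain of the pairs. *)
have gainE : \sum_(i | i != ord_max) pair_gain x (phi i)
           = \sum_(i | i != ord0) pair_gain x (psi i).
  transitivity (\sum_(p in O) pair_gain x p).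
    rewrite -phiO big_imset //=; apply: eq_bigl => i; by rewrite !inE.
  rewrite -psiO big_imset //=; apply: eq_bigl => i; by rewrite !inE.
have upper : sum_rate x (client_graph O)
    <= log_scale * (\sum_i ln (x i) + \sum_(i | i != ord0) g i + g ord_max).
  rewrite /sum_rate (bigD1 ord_max) //=.
  have [j jm ej] := feasible_neighbour ord_max hW fO.
  apply: (@le_trans _ _ (log_scale * (ln (x ord_max) + g ord_max) +
     \sum_(i | i != ord_max) log_scale * (ln (x i) + pair_gain x (phi i)))).
    apply: lerD.
      apply: le_trans (max_rate_le_log_bound hl jm ej) _.
      by rewrite log_bound_pair // ler_pM2l // lerD2l g_edge.
    apply: ler_sum => i im; have [k [-> ki eik]] := phiP i im.
    by rewrite -log_bound_pair //; apply: max_rate_le_log_bound.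
  rewrite -mulr_sumr big_split /= gainE -mulrDr ler_pM2l //.
  rewrite [\sum_i ln (x i)](bigD1 ord_max) //=.
  have : \sum_(i | i != ord0) pair_gain x (psi i) <= \sum_(i | i != ord0) g i.
    by apply: ler_sum => i i0; have [k [-> ki _]] := psiP i i0; apply: g_edge.
  lra.
apply: le_trans upper _.
rewrite /sum_rate [leRHS](bigD1 ord0) //= [\sum_i ln (x i)](bigD1 ord0) //=.
(* [g ord_max] is the gain of [{U_1, U_N}], so by symmetry it can be credited to [U_1], whose worst
   neighbour in the star is [U_N]. *)
apply: (@le_trans _ _ (log_scale * (ln (x ord0) + g ord_max) +
     \sum_(i | i != ord0) log_scale * (ln (x i) + g i))).
  rewrite -mulr_sumr big_split /= -mulrDr ler_pM2l //; lra.
apply: lerD.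
  have e0 : client_graph (star_ordering n) ord0 ord_max by rewrite client_graph_star.
  apply: le_trans (rate_bound_max_le_max_rate hx e0).
  by rewrite hl // log_boundE // [x ord0 + _]addrC.
apply: ler_sum => i i0.
have ei : client_graph (star_ordering n) i ord0.
  by rewrite client_graph_star i0 eqxx orbT.
apply: (le_max_rate ei) => k; rewrite client_graph_star (negbTE i0) /=.
by move=> /andP[_ /eqP->]; rewrite hl // log_boundE.
Qed.

(** * The gap to an arbitrary feasible ordering *)

(** Uses [1 + (a + a)^-1 = (1 + 2 * a) / (2 * a)], and the same for [b]; the factors 2 cancel. *)
Lemma ln_ratioE (a b : R) : 0 < a -> 0 < b ->
  ln ((b * (1 + 2 * a)) / (a * (1 + 2 * b)))
    = ln (1 + (a + a)^-1) - ln (1 + (b + b)^-1).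
Proof.
move=> a0 b0; have D (c : R) : 0 < c -> 0 < 1 + (c + c)^-1.
  by move=> c0; rewrite addr_gt0 ?invr_gt0 ?addr_gt0.
rewrite -ln_div ?posrE ?D //; congr ln; field.
by rewrite !gt_eqF ?mulr_gt0 ?addr_gt0 ?ltr01.
Qed.

Lemma star_gap x (W : zmodType) (O : ordering n) :
  (exists w : W, w != 0) -> snr_profile x -> 1 <= x ord0 -> feasible W O ->
  sum_rate x (client_graph (star_ordering n)) - sum_rate x (client_graph O)
    <= 2^-1 * log2 ((x ord_max * (1 + 2 * x ord0))
                    / (x ord0 * (1 + 2 * x ord_max))).
Proof.
move=> hW hx x1 fO; rewrite /log2 ln_ratioE ?snr_gt0 //.
set d := ln _ - ln _.
rewrite /sum_rate -sumrB (bigD1 ord0) //=.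
(* The bound is split as 0 for [U_1] and [log_scale * d] for each of the [N - 1] other users; the
   count cancels the [N - 1] in [log_scale]. *)
have -> : 2^-1 * (d / ln 2) = 0 + \sum_(i : 'I_n.+2 | i != ord0) log_scale * d.
  rewrite sumr_const.
  have -> : #|[pred i : 'I_n.+2 | i != ord0]| = n.+1.
    by rewrite -[RHS]/(n.+2.-1) -[in RHS](card_ord n.+2) -(cardC1 ord0).
  rewrite add0r -[RHS]mulr_natr /log_scale.
  have ln2N0 : ln 2 != 0 :> R by rewrite gt_eqF // ln_gt0 // ltr1n.
  have nN0 : n.+1%:R != 0 :> R by rewrite pnatr_eq0.
  move: (n.+1%:R : R) nN0 => m mN0; field.
  exact/andP.
apply: lerD.
  have [j _ ej] := feasible_neighbour ord0 hW fO.
  rewrite subr_le0; apply: le_trans (rate_bound_max_le_max_rate hx ej).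
  by apply: max_rate_le; rewrite client_graph_star.
apply: ler_sum => i i0.
have [j _ ej] := feasible_neighbour i hW fO.
have ei : client_graph (star_ordering n) i ord0.
  by rewrite client_graph_star i0 eqxx orbT.
apply: le_trans (lerB (max_rate_le x ei) (rate_bound_max_le_max_rate hx ej)) _.
rewrite !not_too_low_ge1 // !log_boundE // -mulrBr ler_pM2l ?log_scale_gt0 //.
rewrite opprD addrACA subrr add0r /d; apply: lerB; apply: ln1Dinv_le; rewrite ?addr_gt0 ?snr_gt0 //.
  by rewrite lerD2r snr_ge_min.
by rewrite lerD2r snr_le_max.
Qed.

End RateBounds.

(** * The limit at high SNR *)

#[local] Instance high_snr_filter (R : realType) (n : nat) : Filter (high_snr R n).
Proof.
apply: filter_from_filter; first by exists 0.
move=> M M' _ _; exists (Num.max M M') => // x [hx].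
by rewrite ge_max => /andP[xM xM'].
Qed.

Theorem mainTheorem4 (R : realType) (n : nat)
    (W : zmodType) (hW : exists w : W, w != 0) :
  [/\ forall x : 'I_n.+2 -> R, snr_profile x -> not_too_low x ->
        optimal_ordering W x (star_ordering n),
      \forall x \near high_snr R n,
        forall O' : ordering n, feasible W O' ->
          sum_rate x (client_graph (star_ordering n))
            - sum_rate x (client_graph O')
          <= 2^-1 * log2 ((x ord_max * (1 + 2 * x ord0))
                          / (x ord0 * (1 + 2 * x ord_max)))
    & forall O' : ordering n, feasible W O' ->
        sum_rate x (client_graph (star_ordering n))
          - sum_rate x (client_graph O') @[x --> high_snr R n] --> 0].
Proof.
split.
- move=> x hx hl; split; first exact: feasible_star.
  by move=> O'; apply: star_optimal.
- by exists 1 => // x [hx x1] O'; apply: star_gap.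
move=> O' fO; apply/cvgrPdist_le => eps eps0.
(* The threshold 1 gives the gap bound and [not_too_low]; the other one gives
   [(x ord0 + x ord0)^-1 <= eps * ln 2]. *)
exists (Num.max 1 (eps * ln 2)^-1) => // x [hx]; rewrite ge_max => /andP[x1 xe].
have x0 := snr_gt0 ord0 hx; have xN := snr_gt0 ord_max hx.
have ln2_gt0 : 0 < ln 2 :> R by rewrite ln_gt0 // ltr1n.
have hl : not_too_low x by move=> i j _; apply: not_too_low_ge1.
(* Optimality of the star makes the difference nonnegative, so only the upper bound remains. *)
have ge0 := star_optimal hW hx hl fO.
rewrite sub0r normrN ger0_norm ?subr_ge0 //.
apply: le_trans (star_gap hW hx x1 fO) _; rewrite /log2 ln_ratioE //.
have lnN : 0 <= ln (1 + (x ord_max + x ord_max)^-1).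
  by rewrite ln_ge0 // lerDl invr_ge0 addr_ge0 // ltW.
have ln1 : ln (1 + (x ord0 + x ord0)^-1) <= (x ord0 + x ord0)^-1.
  by rewrite le_ln1Dx // (lt_trans _ (_ : 0 < _)) // ?invr_gt0 ?addr_gt0 // oppr_lt0.
rewrite mulrA ler_pdivrMr //.
have : (x ord0 + x ord0)^-1 <= eps * ln 2.
  rewrite invf_ple ?posrE ?addr_gt0 ?mulr_gt0 //.
  by apply: le_trans xe _; rewrite lerDl ltW.
have := mulr_gt0 eps0 ln2_gt0.
lra.
Qed.
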